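(* Let $m\le n$ be positive integers and let $\mathcal{P}=\mathcal{P}(m,n)$ be the perfect matching polytope of the grid graph $\mathcal{G}(m,n)$. Then $\mathcal{P}$ is Gorenstein of index $k$ (for some $k$) if and only if one of the following holds: (1) $m=1$ and $n$ is even, in which case $\mathcal{P}$ is a point; (2) $m=2$, in which case $k=2$ if $n=2$ and $k=3$ if $n>2$; (3) $m=3$ and $n$ is even, in which case $k=5$; (4) $m=n=4$, in which case $k=4$.
   Context: The $m\times n$ grid graph $\mathcal{G}(m,n)$ has vertex set $\{(i,j)\in\mathbf{Z}^2: 0\le i<n,\ 0\le j<m\}$, two vertices $(i,j),(i',j')$ being adjacent iff $|i-i'|+|j-j'|=1$. A perfect matching of a graph $G$ is a set $M\subseteq E(G)$ such that every vertex is incident with exactly one edge of $M$; the perfect matching polytope of $G$ is the convex hull in $\mathbf{R}^{E(G)}$ of the incidence vectors of all perfect matchings. For an integral polytope $\mathcal{P}$ and positive integer $t$, $L_{\mathcal{P}}(t)$ is the number of integer points in $t\mathcal{P}$ (with $L_{\mathcal{P}}(0)=1$) and $L_{\mathcal{P}^\circ}(t)$ the number of integer points in the relative interior of $t\mathcal{P}$. $\mathcal{P}$ is Gorenstein of index $k$ if $L_{\mathcal{P}^\circ}(t)=L_{\mathcal{P}}(t-k)$ for all integers $t\ge k$ and $L_{\mathcal{P}^\circ}(t)=0$ for all positive integers $t<k$; equivalently (for nonempty $\mathcal{P}$) its Ehrhart $h$-vector is palindromic. *)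

(* Defs.v *)
From HB Require Import structures.
From mathcomp Require Import all_boot all_order all_algebra.
From mathcomp Require Import finmap.
From mathcomp Require Import all_classical all_reals all_analysis.

Set Implicit Arguments.
Unset Strict Implicit.
Unset Printing Implicit Defensive.

Import Order.TTheory GRing.Theory Num.Theory.
Import numFieldNormedType.Exports.

Local Open Scope classical_set_scope.
Local Open Scope ring_scope.

(* The pair (i, j) has i < n and j < m: the first coordinate runs over the
   n columns, the second over the m rows. *)
Definition grid_adj (m n : nat) : rel ('I_n * 'I_m) :=
  fun u v => (`|((u.1 : nat)%:Z - (v.1 : nat)%:Z)%R|
              + `|((u.2 : nat)%:Z - (v.2 : nat)%:Z)%R| == 1)%N.
Arguments grid_adj : clear implicits.

Definition edges (T : finType) (adj : rel T) : {set {set T}} :=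
  [set [set uv.1; uv.2]%SET | uv : T * T & adj uv.1 uv.2]%SET.

Definition perfect_matching (T : finType) (adj : rel T) (M : {set {set T}}) :=
  (M \subset edges adj) /\
  forall v : T, #|[set e in M | v \in e]%SET| = 1%N.

(* R^E(G) is 'rV[R]_#|edges adj|, whose i-th coordinate belongs to the edge
   enum_val i. *)
Definition incidence (R : realType) (T : finType) (adj : rel T)
    (M : {set {set T}}) : 'rV[R]_#|edges adj| :=
  \row_i (enum_val i \in M)%:R.

Definition convex_hull (R : realType) (V : lmodType R) (A : set V) : set V :=
  [set x | exists (N : nat) (w : 'I_N -> R) (a : 'I_N -> V),
     [/\ forall i, A (a i), forall i, 0 <= w i, \sum_i w i = 1
       & x = \sum_i w i *: a i]].

Definition affine_hull (R : realType) (V : lmodType R) (A : set V) : set V :=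
  [set x | exists (N : nat) (w : 'I_N -> R) (a : 'I_N -> V),
     [/\ forall i, A (a i), \sum_i w i = 1 & x = \sum_i w i *: a i]].

Definition perfect_matching_polytope (R : realType) (T : finType)
    (adj : rel T) : set 'rV[R]_#|edges adj| :=
  convex_hull [set incidence R adj M | M in [set M | perfect_matching adj M]].

Arguments perfect_matching_polytope R {T} adj.

Definition relative_interior (R : realType) (d : nat) (S : set 'rV[R]_d) :
    set 'rV[R]_d :=
  [set x | S x /\ within (affine_hull S) (nbhs x) S].

Definition dilate (R : realType) (d : nat) (t : nat) (S : set 'rV[R]_d) :
    set 'rV[R]_d :=
  [set t%:R *: x | x in S].

(* fset_set returns the empty set on infinite sets; here S is always bounded,
   so that the set of its integer points is finite. *)
Definition nb_integer_points (R : realType) (d : nat) (S : set 'rV[R]_d) : nat :=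
  #|` fset_set [set x | S x /\ forall i, x ord0 i \is a Num.int]|%fset.

Definition ehrhart (R : realType) (d : nat) (P : set 'rV[R]_d) (t : nat) : nat :=
  if t == 0%N then 1%N else nb_integer_points (dilate t P).

(* Only meaningful for t > 0. *)
Definition ehrhart_interior (R : realType) (d : nat) (P : set 'rV[R]_d)
    (t : nat) : nat :=
  nb_integer_points (relative_interior (dilate t P)).

(* Positivity of k is part of the notion: with k = 0 the empty polytope would
   satisfy the two counting conditions for all positive t. *)
Definition gorenstein (R : realType) (d : nat) (P : set 'rV[R]_d) (k : nat) :=
  [/\ (0 < k)%N,
      forall t : nat, (k <= t)%N -> ehrhart_interior P t = ehrhart P (t - k)
    & forall t : nat, (0 < t < k)%N -> ehrhart_interior P t = 0%N].

(* Main.v *)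
Require Import Defs.
From mathcomp Require Import all_boot all_order all_algebra.
From mathcomp Require Import finmap lra zify.
From mathcomp Require Import all_classical all_reals all_analysis.
Set Implicit Arguments.
Unset Strict Implicit.
Unset Printing Implicit Defensive.
Import Order.TTheory GRing.Theory Num.Theory.
Import numFieldNormedType.Exports.

(** The grid is bipartite, so by Hall's theorem the integer points of tP are
    the labelings of the edges by natural numbers with sum t around every
    vertex.  When every edge lies in some perfect matching, those in the
    relative interior are the labelings by positive integers.  Comparing
    cardinalities, P is Gorenstein of index k iff some positive labeling with
    vertex sums k is a lower bound, edge by edge, of all positive labelings.
    For m = 2, m = 3 and m = n = 4 this least labeling is explicit.  If m >= 4
    and n >= 5, each of the three edges at some boundary vertex has label 1 in
    some positive labeling, so a least labeling would force k = 3, whereas an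
    inner vertex of degree four forces k >= 4.  If m and n are odd there is no
    perfect matching, and if m = 1 there is at most one. *)

(** * Hall's marriage theorem *)

(* Rado's proof: as long as some neighbourhood has two points, one of them can
   be dropped without violating Hall's condition. *)
Lemma hall (T U : finType) (N : T -> {set U}) :
  (forall B : {set T}, #|B| <= #|\bigcup_(u in B) N u|)%N ->
  exists f : T -> U, injective f /\ forall u, f u \in N u.
Proof.
have [k] := ubnP (\sum_u #|N u|)%N.
elim: k N => // k IHk N; rewrite ltnS => sumN hN.
have [/existsP[v /card_gt1P[x [y [xN yN xy]]]]|] :=
    boolP [exists v, 1 < #|N v|]%N; last first.
  rewrite negb_exists => /forallP N1.
  have Nf u : {w | N u = [set w]%SET}.
    apply/cid; have := N1 u; have := hN [set u]%SET.
    rewrite big_set1 cards1 -leqNgt => a b.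
    have /eqP/cards1P[w ->] : #|N u| = 1%N by apply/eqP; rewrite eqn_leq b a.
    by exists w.
  exists (fun u => projT1 (Nf u)); split=> [u v|u]; last first.
    by case: (Nf u) => w /= ->; rewrite inE.
  case: (Nf u) (Nf v) => w /= Nu [w' /= Nv] ww'; apply/eqP/negPn/negP => uv.
  have := hN [set u; v]%SET; rewrite cards2 uv big_setU1 ?inE //= big_set1.
  by rewrite Nu Nv ww' finset.setUid cards1.
pose D z u := if u == v then (N v :\ z)%SET else N u.
have Dv z : D z v = (N v :\ z)%SET by rewrite /D eqxx.
have DN z u : u != v -> D z u = N u by rewrite /D => /negbTE ->.
have hD z : z \in N v ->
    (forall B : {set T}, #|B| <= #|\bigcup_(u in B) D z u|)%N ->
    exists f : T -> U, injective f /\ forall u, f u \in N u.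
  move=> zN hz; have [|f [fI fD]] := IHk (D z) _ hz.
    apply: leq_trans sumN; rewrite (bigD1 v) //= [ltnRHS](bigD1 v) //=.
    rewrite Dv (cardsD1 z (N v)) zN add1n addSn ltnS leq_add2l leq_sum // => u uv.
    by rewrite DN.
  exists f; split=> // u; have := fD u; rewrite /D.
  by case: eqP => // ->; rewrite inE => /andP[].
have [/forallP/(hD _ xN)//|/forallPn[B]] :=
  boolP [forall B : {set T}, #|B| <= #|\bigcup_(u in B) D x u|]%N.
have [/forallP/(hD _ yN)//|/forallPn[C]] :=
  boolP [forall B : {set T}, #|B| <= #|\bigcup_(u in B) D y u|]%N.
rewrite -!ltnNge => ltC ltB; exfalso.
have inB z (A : {set T}) : (#|\bigcup_(u in A) D z u| < #|A|)%N -> v \in A.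
  apply: contraLR => vA; rewrite -leqNgt (leq_trans (hN A)) // subset_leq_card //.
  apply/bigcupsP => u uA; have uv : u != v by apply: contraNneq vA => <-.
  by rewrite -(DN z u uv); apply: (finset.bigcup_sup u).
have vB := inB _ _ ltB; have vC := inB _ _ ltC.
(* [B] and [C] violate Hall's condition after dropping [x], respectively [y], and both contain [v].
   As [x] and [y] differ, [P :|: Q] still contains all neighbours of [B :|: C], and [P :&: Q]
   contains those of [(B :&: C) :\ v]. Hence |P| + |Q| >= |B| + |C| - 1, against |P| < |B| and |Q| <
   |C|. *)
set P := (\bigcup_(u in B) _)%SET in ltB; set Q := (\bigcup_(u in C) _)%SET in ltC.
have PQ : (\bigcup_(u in B :|: C) N u \subset P :|: Q)%SET.
  apply/bigcupsP => u; have [-> _|uv] := eqVneq u v.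
    apply/fintype.subsetP => w wN; rewrite inE.
    have [wx|wx] := eqVneq w x.
      by rewrite orbC; apply/orP; left; apply/bigcupP; exists v;
        rewrite // Dv !inE wN andbT wx.
    by apply/orP; left; apply/bigcupP; exists v; rewrite // Dv !inE wN andbT.
  rewrite inE => /orP[uB|uC]; apply/fintype.subsetP => w wN; rewrite inE; apply/orP.
    by left; apply/bigcupP; exists u; rewrite // DN.
  by right; apply/bigcupP; exists u; rewrite // DN.
have PQ' : (\bigcup_(u in (B :&: C) :\ v) N u \subset P :&: Q)%SET.
  apply/bigcupsP => u; rewrite !inE => /and3P[uv uB uC].
  apply/fintype.subsetP => w wN; rewrite inE.
  by apply/andP; split; apply/bigcupP; exists u; rewrite // DN.
have := leq_trans (hN _) (subset_leq_card PQ).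
have := leq_trans (hN _) (subset_leq_card PQ').
have := cardsUI P Q; have := cardsUI B C.
rewrite (cardsD1 v (B :&: C)%SET) inE vB vC /=.
lia.
Qed.

(** * Edge labelings with constant vertex sums on a two-coloured graph *)

Section Labelings.
Local Open Scope ring_scope.
Variables (R : realType) (T : finType) (adj : rel T) (c : T -> bool).
Hypotheses (adj_sym : symmetric adj)
  (adj_col : forall u v, adj u v -> c v = ~~ c u).

Local Notation vect := 'rV[R]_#|edges adj|.

Definition vertex_sum (x : vect) (u : T) : R :=
  \sum_(i < #|edges adj| | u \in (enum_val i : {set T})) x ord0 i.

Definition labeling (t : R) (x : vect) :=
  (forall i, 0 <= x ord0 i) /\ (forall u, vertex_sum x u = t).

(* The value is 0 when e is not an edge. *)
Definition edge_label (x : vect) (e : {set T}) : R :=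
  \sum_(i < #|edges adj| | enum_val i == e) x ord0 i.

Lemma adj_neq u v : adj u v -> u != v.
Proof. by move=> /adj_col cv; apply/eqP => uv; move: cv; rewrite uv; case: (c v). Qed.

Lemma set2_inj (u v w : T) : u != v -> [set u; v]%SET = [set u; w]%SET -> v = w.
Proof.
move=> uv /setP/(_ v); rewrite !inE eqxx orbT eq_sym (negbTE uv) /=.
by move=> /esym/eqP.
Qed.

Lemma mem_edges u v : ([set u; v]%SET \in edges adj) = adj u v.
Proof.
apply/imsetP/idP => [[[a b]] /=|uv]; last by exists (u, v); rewrite ?inE.
rewrite inE /= => ab E; have nab := adj_neq ab.
have : u \in [set a; b]%SET by rewrite -E !inE eqxx.
rewrite !inE => /orP[]/eqP ua.
  by rewrite ua in E *; rewrite -(set2_inj nab (esym E)).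
rewrite ua in E *; have nba : b != a by rewrite eq_sym.
have E' : [set b; a]%SET = [set b; v]%SET by rewrite E finset.setUC.
by rewrite -(set2_inj nba E') adj_sym.
Qed.

Lemma edge_through e u : e \in edges adj -> u \in e ->
  exists2 v, adj u v & e = [set u; v]%SET.
Proof.
move=> /imsetP[[a b]]; rewrite inE /= => ab ->.
rewrite !inE => /orP[]/eqP ->; first by exists b.
by exists a; rewrite 1?adj_sym // finset.setUC.
Qed.

Lemma edge_ends e : e \in edges adj -> exists u v, adj u v /\ e = [set u; v]%SET.
Proof. by move=> /imsetP[[a b]]; rewrite inE /= => ab ->; exists a, b. Qed.

Lemma edge_label_val x i : edge_label x (enum_val i) = x ord0 i.
Proof.
rewrite /edge_label (big_pred1 i) // => j /=.
by apply/eqP/eqP => [/enum_val_inj|->].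
Qed.

Lemma edge_label0 x u v : ~~ adj u v -> edge_label x [set u; v]%SET = 0.
Proof.
rewrite -mem_edges => ne; apply: big_pred0 => i.
by apply: contraNF ne => /eqP <-; exact: enum_valP.
Qed.

(** Reads edge values as a symmetric matrix over all pairs of vertices, so that vertex sums become
    row sums; non-edges contribute 0. *)
Lemma vertex_sumE x u : vertex_sum x u = \sum_v edge_label x [set u; v]%SET.
Proof.
rewrite /vertex_sum /edge_label [RHS](exchange_big_dep predT) //= [LHS]big_mkcond /=.
apply: eq_bigr => i _; case: ifPn => ui.
  have [v uv iv] := edge_through (enum_valP i) ui.
  rewrite (big_pred1 v) // => w /=; rewrite iv.
  by apply/eqP/eqP => [/(set2_inj (adj_neq uv))|->].
rewrite big_pred0 // => v; apply: contraNF ui => /eqP ->.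
by rewrite !inE eqxx.
Qed.

Lemma vertex_sumD x y u : vertex_sum (x + y) u = vertex_sum x u + vertex_sum y u.
Proof. by rewrite -big_split; apply: eq_bigr => i _; rewrite mxE. Qed.

Lemma vertex_sumZ a x u : vertex_sum (a *: x) u = a * vertex_sum x u.
Proof. by rewrite mulr_sumr; apply: eq_bigr => i _; rewrite mxE. Qed.

Lemma vertex_sum_lincomb N (w : 'I_N -> R) (a : 'I_N -> vect) u :
  vertex_sum (\sum_i w i *: a i) u = \sum_i w i * vertex_sum (a i) u.
Proof.
rewrite [LHS](eq_bigr (fun j => \sum_i w i * a i ord0 j)).
  by rewrite exchange_big; apply: eq_bigr => i _; rewrite mulr_sumr.
by move=> j _; rewrite summxE; apply: eq_bigr => i _; rewrite mxE.
Qed.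

Lemma vertex_sum_incidence M u : perfect_matching adj M ->
  vertex_sum (incidence R adj M) u = 1.
Proof.
move=> [Me /(_ u) M1].
rewrite /vertex_sum (eq_bigr (fun i => (enum_val i \in M)%:R)); last first.
  by move=> i _; rewrite mxE.
rewrite -(big_enum_val_cond (fun e : {set T} => u \in e)
  (fun e => (e \in M)%:R : R)) /=.
rewrite (eq_bigr (fun e => if e \in M then 1 else 0)); last first.
  by move=> e _; case: (e \in M).
rewrite -big_mkcondr sumr_const -[RHS]/(1%:R) -M1; congr (_%:R).
apply: eq_card => e; rewrite !inE [LHS]/in_mem /=.
have [eM|_] := boolP (e \in M); last by rewrite !andbF.
by rewrite !andbT (fintype.subsetP Me _ eM).
Qed.

(** Hall's theorem is applied to all vertices at once and gives a permutation [f] along edges of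
    positive label. Since [f] swaps the colours, the edges from [u] to [f u] with [c u] true already
    form a perfect matching. *)
Lemma labeling_matching s x : 0 < s -> labeling s x ->
  exists2 M, perfect_matching adj M & forall i, enum_val i \in M -> 0 < x ord0 i.
Proof.
move=> s0 [x0 xs].
pose A u v := edge_label x [set u; v]%SET.
have A0 u v : 0 <= A u v by apply: sumr_ge0 => i _.
have AC u v : A u v = A v u by rewrite /A finset.setUC.
have sA u : \sum_v A u v = s by rewrite -vertex_sumE.
have Aadj u v : 0 < A u v -> adj u v.
  by apply: contraLR => nuv; rewrite /A edge_label0 // ltxx.
have [|f [fI fA]] := @hall T T (fun u => [set v | 0 < A u v]%SET).
  (* The rows of [B] have total weight s|B|, all of it in the columns of [N], whose total weight is
     s|N|. *)
  move=> B; set N := (\bigcup_(u in B) _)%SET.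
  rewrite -(@ler_nat R) -(ler_pM2r s0).
  have -> : #|B|%:R * s = \sum_(u in B) \sum_(v in N) A u v.
    rewrite mulr_natl -sumr_const; apply: eq_bigr => u uB.
    rewrite -(sA u) [RHS]big_mkcond; apply: eq_bigr => v _.
    case: ifPn => // vN; apply/eqP; rewrite eq_le A0 andbT leNgt.
    by apply: contraNN vN => vA; apply/bigcupP; exists u; rewrite // inE.
  rewrite exchange_big mulr_natl -sumr_const; apply: ler_sum => v _ /=.
  rewrite -(sA v) big_mkcond; apply: ler_sum => u _.
  by case: ifP; rewrite // AC.
have {}fA u : 0 < A u (f u) by have := fA u; rewrite inE.
have fadj u : adj u (f u) by exact: Aadj.
pose M := [set [set u; f u]%SET | u in [set u | c u]%SET]%SET.
exists M; last first.
  by move=> i /imsetP[u _ iu]; rewrite -edge_label_val iu; apply: fA.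
split.
  by apply/fintype.subsetP => e /imsetP[u _ ->]; rewrite mem_edges.
have [g fg gf] := injF_bij fI.
(* The end of colour true of the only matching edge at [v]. *)
move=> v; pose u := if c v then v else g v.
have cu : c u.
  rewrite /u; case: ifPn => // cv; have := adj_col (fadj (g v)).
  by rewrite gf (negbTE cv); case: (c (g v)).
apply/eqP/cards1P; exists [set u; f u]%SET; apply/setP => e.
rewrite !inE; apply/andP/eqP => [[/imsetP[w]]|->]; last first.
  split; first by apply/imsetP; exists u; rewrite // inE.
  by rewrite /u; case: ifP; rewrite !inE ?gf eqxx ?orbT.
rewrite inE => cw -> vw; suff -> : u = w by [].
move: vw; rewrite /u !inE => /orP[]/eqP ->; first by rewrite cw.
by rewrite (adj_col (fadj w)) cw /= fg.
Qed.
End Labelings.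

(** * The matching polytope, its dilates and their relative interiors *)

Section Polytope.
Local Open Scope ring_scope.
Local Open Scope classical_set_scope.
Variables (R : realType) (T : finType) (adj : rel T) (c : T -> bool) (u0 : T).
Hypotheses (adj_sym : symmetric adj)
  (adj_col : forall u v, adj u v -> c v = ~~ c u).

Local Notation vect := 'rV[R]_#|edges adj|.
Local Notation P := (perfect_matching_polytope R adj).

Lemma vertex_label_le (x : vect) u i : (forall i, 0 <= x ord0 i) ->
  u \in (enum_val i : {set T}) -> x ord0 i <= vertex_sum x u.
Proof.
by move=> x0 ui; rewrite /vertex_sum (bigD1 i) //= lerDl sumr_ge0.
Qed.

Lemma label_le s (x : vect) i : labeling s x -> x ord0 i <= s.
Proof.
move=> [x0 xs]; have [u [v [_ iuv]]] := edge_ends (enum_valP i).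
by rewrite -(xs u) vertex_label_le // iuv !inE eqxx.
Qed.

(** As in the Birkhoff-von Neumann theorem: take a perfect matching inside the support, subtract it
    with its smallest label as weight, and recurse on the smaller support. *)
Lemma labeling_decomposition s (x : vect) : labeling s x ->
  exists N (w : 'I_N -> R) (M : 'I_N -> {set {set T}}),
    [/\ forall i, perfect_matching adj (M i), forall i, 0 <= w i,
        \sum_i w i = s & x = \sum_i w i *: incidence R adj (M i)].
Proof.
have [k] := ubnP #|[set i | x ord0 i != 0]%SET|.
elim: k s x => // k IHk s x; rewrite ltnS => supp xl.
have [x0 xs] := xl.
have s0 : 0 <= s by rewrite -(xs u0) sumr_ge0.
have [s_eq0|sneq0] := eqVneq s 0.
  exists 0%N, (fun=> 0), (fun=> finset.set0); split=> [[]||  |] //.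
    by rewrite big_ord0.
  rewrite big_ord0; apply/rowP => i; rewrite mxE; apply/eqP.
  by rewrite eq_le x0 -{1}s_eq0 (label_le _ xl).
have {sneq0}s_gt0 : 0 < s by rewrite lt_neqAle eq_sym sneq0.
have [M Mp Mx] := labeling_matching adj_sym adj_col s_gt0 xl.
have [i1 i1M] : exists i : 'I_#|edges adj|, enum_val i \in M.
  have [Me /(_ u0) M1] := Mp.
  have /card_gt0P[e] : (0 < #|[set e in M | u0 \in e]%SET|)%N by rewrite M1.
  rewrite inE => /andP[eM _]; have eE := fintype.subsetP Me _ eM.
  by exists (enum_rank_in eE e); rewrite enum_rankK_in.
(* The label at [im] becomes 0, so the support strictly shrinks, and minimality keeps the other
   labels nonnegative. *)
pose im := [arg min_(i < i1 | enum_val i \in M) x ord0 i]%O.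
have [imM im_min] : enum_val im \in M /\
    forall i, enum_val i \in M -> x ord0 im <= x ord0 i.
  by rewrite /im; case: arg_minP.
pose a := x ord0 im; pose y := x - a *: incidence R adj M.
have [| |N [w [M' [M'p w0 ws yE]]]] := IHk (s - a) y.
- apply: leq_trans supp; apply/proper_card/properP; split.
    apply/fintype.subsetP => i; rewrite !inE !mxE.
    apply: contraNneq => xi0; rewrite xi0; case: (boolP (_ \in M)) => [/Mx|].
      by rewrite xi0 ltxx.
    by rewrite mulr0 subrr.
  exists im; first by rewrite inE gt_eqF // Mx.
  by rewrite inE !mxE imM mulr1 subrr eqxx.
- split=> [i|u].
    rewrite !mxE; case: (boolP (_ \in M)) => iM; rewrite ?mulr1 ?mulr0 ?subr0 //.
    by rewrite subr_ge0 im_min.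
  rewrite /y -scaleNr vertex_sumD xs vertex_sumZ vertex_sum_incidence //.
  by rewrite mulr1.
exists N.+1, (fun i => oapp w a (unlift ord0 i)),
  (fun i => oapp M' M (unlift ord0 i)); split.
- by move=> i; case: unliftP => [j|] _ /=; [exact: M'p|exact: Mp].
- by move=> i; case: unliftP => [j|] _ /=; [exact: w0|exact: x0].
- rewrite big_ord_recl unlift_none /= (eq_bigr w); last by move=> i _; rewrite liftK.
  by rewrite ws addrC subrK.
- rewrite big_ord_recl unlift_none /=.
  rewrite (eq_bigr (fun i => w i *: incidence R adj (M' i))); last first.
    by move=> i _; rewrite liftK.
  by rewrite -yE /y addrC subrK.
Qed.

(** Vertex sums are linear and equal 1 on matchings, which gives one inclusion. For the other, the
    weights in the decomposition of a labeling add up to [t]; dividing by [t] makes them convex. *)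
Lemma dilate_polytope t : (0 < t)%N ->
  dilate t P = [set x | labeling t%:R x].
Proof.
move=> t0; have tR : (t%:R : R) != 0 by rewrite pnatr_eq0 -lt0n.
apply/seteqP; split=> [x [y [N [w [a [aM w0 w1 ->]]]] <-]|x /= xl].
  have {}aM i : exists2 M, perfect_matching adj M & incidence R adj M = a i.
    by have [M ? ?] := aM i; exists M.
  split=> [i|u].
    rewrite mxE mulr_ge0 // summxE sumr_ge0 // => j _.
    by have [M _ <-] := aM j; rewrite !mxE mulr_ge0.
  rewrite vertex_sumZ vertex_sum_lincomb (eq_bigr w) ?w1 ?mulr1 // => i _.
  by have [M Mp <-] := aM i; rewrite vertex_sum_incidence // mulr1.
have [N [w [M [Mp w0 ws xE]]]] := labeling_decomposition xl.
exists (t%:R^-1 *: x); last by rewrite scalerA mulfV // scale1r.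
exists N, (fun i => t%:R^-1 * w i), (fun i => incidence R adj (M i)); split.
- by move=> i; exists (M i) => //; exact: Mp.
- by move=> i; rewrite mulr_ge0 // invr_ge0.
- by rewrite -mulr_sumr ws mulVf.
- by rewrite xE scaler_sumr; apply: eq_bigr => i _; rewrite scalerA.
Qed.

Lemma relative_interior_labeling t (s : R) (z : vect) : 0 < s ->
  labeling s z -> (forall i, 0 < z ord0 i) -> (0 < t)%N ->
  relative_interior (dilate t P) =
  [set x | labeling t%:R x /\ forall i, 0 < x ord0 i].
Proof.
move=> s0 zl z0 t0; rewrite dilate_polytope //; set S := [set x | _].
have tR : 0 < (t%:R : R) by rewrite ltr0n.
apply/seteqP; split=> [x [Sx nx]|x [xl x0]].
  split=> // i; pose z' := (t%:R / s) *: z.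
  have z'l : S z'.
    split=> [j|u]; first by rewrite mxE mulr_ge0 ?zl.1 // divr_ge0 // ltW.
    by rewrite vertex_sumZ zl.2 divfK // gt_eqF.
  have z'0 j : 0 < z' ord0 j by rewrite mxE mulr_gt0 ?z0 // divr_gt0.
  (* A point of the relative interior can be moved slightly away from [z'] without leaving [S]; then
     (1 + e) x_i - e z'_i >= 0 with z'_i > 0 forces x_i > 0. *)
  pose g (e : R) := x + e *: (x - z').
  have [e [e0 Se]] : exists e : R, 0 < e /\ S (g e).
    move: nx; rewrite /within /= => /nbhs_ballP[r /= r0 rS].
    have t1 : 0 < t%:R + 1 :> R by rewrite addr_gt0.
    (* Coordinates of [x] and [z'] lie in [0, t], so those of [x - z'] are at most t in absolute
       value, and t + 1 makes the ball inequality strict. *)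
    exists (r / (t%:R + 1)); split; first by rewrite divr_gt0.
    set e := r / _; have e0 : 0 < e by rewrite divr_gt0.
    have er : e * (t%:R + 1) = r by rewrite divfK // gt_eqF.
    apply: rS.
      split=> // a j; rewrite (ord1 a) /ball /= !mxE opprD addrA subrr sub0r normrN.
      rewrite normrM gtr0_norm // -er ltr_pM2l // ltr_norml.
      have := label_le j Sx; have := label_le j z'l.
      have := Sx.1 j; have := z'l.1 j; rewrite !mxE => *; lra.
    exists 2%N, (fun j => if j == ord0 then 1 + e else - e),
      (fun j => if j == ord0 then x else z'); split.
    - by move=> j; case: ifP.
    - by rewrite !big_ord_recl big_ord0 /=; lra.
    - rewrite !big_ord_recl big_ord0 /= addr0 /g scalerBr scalerDl scale1r.
      by rewrite scaleNr addrA.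
  have := Se.1 i; rewrite !mxE; have := z'0 i; rewrite !mxE => zi gi.
  nra.
split=> //; rewrite /within /=.
have pos : nbhs x [set y : vect | forall i, 0 < y ord0 i].
  apply: (@filter_forall _ _ (fun i (y : vect) => 0 < y ord0 i) (nbhs x) _) => i.
  have xc : (fun y : vect => y ord0 i) @ x --> x ord0 i.
    exact: (@coord_continuous R).
  exact: (cvgr_gt _ xc).
(* Near [x] all coordinates stay positive, and affine combinations preserve the vertex sums, so
   points of the affine hull near [x] are labelings. *)
apply: filterS pos => y y0 [N [w [a [aS w1 yE]]]].
split=> [i|u]; first exact: ltW.
rewrite yE vertex_sum_lincomb (eq_bigr (fun i => w i * t%:R)).
  by rewrite -mulr_suml w1 mul1r.
by move=> i _; rewrite (aS i).2.
Qed.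
End Polytope.

(** * The Gorenstein property in terms of labelings *)

Section Gorenstein.
Local Open Scope ring_scope.
Local Open Scope classical_set_scope.

(** At t = a an index a gives the interior count L(0) = 1, whereas any index b > a gives 0. *)
Lemma gorenstein_uniq (R : realType) d (P : set 'rV[R]_d) k k' :
  gorenstein P k -> gorenstein P k' -> k = k'.
Proof.
have le (a b : nat) : gorenstein P a -> gorenstein P b -> (b <= a)%N.
  move=> [a0 Pa _] [_ _ Pb]; rewrite leqNgt; apply/negP => ab.
  have := Pa a (leqnn a); rewrite Pb ?a0 // subnn.
  by rewrite /ehrhart eqxx.
by move=> h h'; apply/eqP; rewrite eqn_leq !le.
Qed.

Lemma nb_integer_points1 (R : realType) d (p : 'rV[R]_d) :
  (forall i, p ord0 i \is a Num.int) -> nb_integer_points [set p] = 1%N.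
Proof.
move=> pi; rewrite /nb_integer_points.
rewrite (_ : [set x | _] = [set p]) ?fset_set1 ?cardfs1 //.
by apply/seteqP; split=> [x []|x /= ->].
Qed.

Lemma nb_integer_points0 (R : realType) d :
  nb_integer_points (set0 : set 'rV[R]_d) = 0%N.
Proof.
rewrite /nb_integer_points (_ : [set x | _] = set0) ?fset_set0 ?cardfs0 //.
by apply/seteqP; split=> [x []|].
Qed.

Lemma gorenstein_set0 (R : realType) d k : ~ gorenstein (set0 : set 'rV[R]_d) k.
Proof.
move=> [_ /(_ k (leqnn k)) + _]; rewrite subnn /ehrhart_interior /ehrhart eqxx.
rewrite (_ : relative_interior _ = set0) ?nb_integer_points0 //.
by apply/seteqP; split=> [x [[]]|].
Qed.

Lemma gorenstein_set1 (R : realType) d (p : 'rV[R]_d) :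
  (forall i, p ord0 i \is a Num.int) -> gorenstein [set p] 1.
Proof.
move=> pi; have D t : dilate t [set p] = [set t%:R *: p].
  by apply/seteqP; split=> [x [y -> <-]|x ->] //; exists p.
have ti (t : nat) : forall i, (t%:R *: p) ord0 i \is a Num.int.
  by move=> i; rewrite mxE rpredM // rpred_nat.
split=> // [t t1|t /andP[]]; last by case: t.
have -> : ehrhart [set p] (t - 1) = 1%N.
  by rewrite /ehrhart; case: eqP => // _; rewrite D nb_integer_points1.
rewrite /ehrhart_interior D (_ : relative_interior _ = [set t%:R *: p]).
  exact: nb_integer_points1.
apply/seteqP; split=> [x []//|x /= ->]; split=> //.
apply: nearW => x' [N [w [a [ap w1 ->]]]].
rewrite /= (eq_bigr (fun i => w i *: (t%:R *: p))) => [|i _]; last by rewrite ap.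
by rewrite -scaler_suml w1 scale1r.
Qed.

Variables (R : realType) (T : finType) (adj : rel T) (c : T -> bool) (u0 : T).
Hypotheses (adj_sym : symmetric adj)
  (adj_col : forall u v, adj u v -> c v = ~~ c u).

Local Notation vect := 'rV[R]_#|edges adj|.
Local Notation P := (perfect_matching_polytope R adj).

Definition int_labeling (t : nat) (x : vect) :=
  labeling t%:R x /\ forall i, x ord0 i \is a Num.int.

Definition pos_labeling (t : nat) (x : vect) :=
  int_labeling t x /\ forall i, 1 <= x ord0 i.

(** Each label is a natural number at most [t]. Finiteness keeps [fset_set] from returning its
    default, the empty set. *)
Lemma finite_int_labeling t : finite_set [set x | int_labeling t x].
Proof.
pose g (f : {ffun 'I_#|edges adj| -> 'I_t.+1}) : vect := \row_i (f i)%:R.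
apply: (@sub_finite_set _ _ (g @` setT)); last first.
  by apply: finite_image; exact: finite_finset.
move=> x [xl xi].
have xn i : {n : 'I_t.+1 | x ord0 i = n%:R}.
  apply/cid; have : x ord0 i \is a Num.nat by rewrite natrEint xi xl.1.
  move=> /natrP[n xn]; have := label_le i xl; rewrite xn ler_nat => nt.
  by exists (inord n); rewrite inordK.
exists [ffun i => projT1 (xn i)] => //.
by apply/rowP => i; rewrite mxE ffunE; case: (xn i).
Qed.

Lemma finite_pos_labeling t : finite_set [set x | pos_labeling t x].
Proof. by apply: sub_finite_set (finite_int_labeling t) => x []. Qed.

(** At t = 0 the conventional value 1 counts the zero labeling, the only one with vertex sums 0. *)
Lemma ehrhart_labeling t :
  ehrhart P t = #|` fset_set [set x | int_labeling t x]|%fset.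
Proof.
rewrite /ehrhart; case: eqP => [->|/eqP]; last first.
  by rewrite -lt0n => t0; rewrite (dilate_polytope R u0 adj_sym adj_col t0).
rewrite (_ : [set x | _] = [set 0]) ?fset_set1 ?cardfs1 //.
apply/seteqP; split=> [x [xl _]|x /= ->].
  apply/rowP => i; apply/eqP; rewrite mxE eq_le xl.1 andbT.
  exact: (label_le i xl).
split=> [|i]; last by rewrite mxE rpred0.
by split=> [i|u]; rewrite ?mxE // /vertex_sum big1 // => i _; rewrite mxE.
Qed.

Section PositiveLabeling.
Variables (s : nat) (z : vect).
Hypothesis zl : pos_labeling s z.

Lemma ehrhart_interior_labeling t : (0 < t)%N ->
  ehrhart_interior P t = #|` fset_set [set x | pos_labeling t x]|%fset.
Proof.
move=> t0; have z0 i : 0 < z ord0 i by apply: lt_le_trans (zl.2 i).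
(* A positive labeling with sum 0 forces a graph without edges; both sides then count the empty set,
   because t > 0. *)
have [s0|s0] := posnP s.
  have noi (i : 'I_#|edges adj|) : False.
    by have := label_le i zl.1.1; rewrite s0 leNgt z0.
  have vs0 (x : vect) : vertex_sum x u0 = 0.
    by rewrite /vertex_sum big1 // => i; case: (noi i).
  have nol (x : vect) : ~ labeling t%:R x.
    move=> [_ /(_ u0)]; rewrite vs0 => /esym/eqP.
    by rewrite pnatr_eq0 gtn_eqF.
  rewrite /ehrhart_interior /nb_integer_points; congr (#|` fset_set _|%fset).
  apply/seteqP; split=> [x [[+ _] _]|x [[/nol]]//].
  by rewrite (dilate_polytope R u0 adj_sym adj_col t0) => /nol.
have sR : 0 < (s%:R : R) by rewrite ltr0n.
rewrite /ehrhart_interior.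
rewrite (relative_interior_labeling u0 adj_sym adj_col sR zl.1.1 z0 t0).
congr (#|` fset_set _|%fset); apply/seteqP; split=> x.
  move=> [[xl x0] xi]; split=> // i.
  have /natrP[n xn] : x ord0 i \is a Num.nat by rewrite natrEint xi ltW.
  by move: (x0 i); rewrite xn ltr0n ler1n.
by move=> [[xl xi] x1]; split=> //; split=> // i; apply: lt_le_trans (x1 i).
Qed.

(* The index-k condition says that translation by the least positive labeling
   is onto the positive labelings. *)
Lemma gorenstein_labelingP k : gorenstein P k <->
  (0 < k)%N /\ exists2 x, pos_labeling k x &
    forall t y, pos_labeling t y -> forall i, x ord0 i <= y ord0 i.
Proof.
have shift (x : vect) t w : pos_labeling k x -> (k <= t)%N ->
    int_labeling (t - k) w -> pos_labeling t (x + w).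
  move=> [[[x0 xs] xi] x1] kt [[w0 ws] wi]; split; last first.
    by move=> i; rewrite mxE ler_wpDr.
  split; last by move=> i; rewrite mxE rpredD.
  split=> [i|u]; first by rewrite mxE addr_ge0.
  by rewrite vertex_sumD xs ws -natrD subnKC.
have inj (x : vect) : injective (+%R x) by apply: addrI.
split=> [[k0 Pk Plt]|[k0 [x xp xmin]]].
  (* At t = k the interior count is L(0) = 1, so exactly one positive labeling has sum [k]: the
     candidate [x]. *)
  split=> //; have := Pk k (leqnn k).
  rewrite subnn /ehrhart eqxx ehrhart_interior_labeling // => /eqP/cardfs1P[x Ex].
  have xp : pos_labeling k x.
    have : x \in fset_set [set x | pos_labeling k x] by rewrite Ex inE.
    by rewrite in_fset_set ?inE //; exact: finite_pos_labeling.
  exists x => // t y yp i.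
  have [t0|t0] := posnP t.
    by have := label_le i yp.1.1; have := yp.2 i; rewrite t0 => *; lra.
  have yin : y \in fset_set [set x | pos_labeling t x].
    by rewrite in_fset_set ?inE //; exact: finite_pos_labeling.
  have [kt|tk] := leqP k t; last first.
    have := Plt t; rewrite t0 tk ehrhart_interior_labeling // => /(_ isT)/eqP.
    by rewrite cardfs_eq0 => /eqP E0; rewrite E0 inE in yin.
  have := Pk t kt; rewrite ehrhart_interior_labeling // ehrhart_labeling => card_eq.
  (* Translation by [x] injects the labelings of sum t - k into the positive ones of sum t. Equal
     cardinalities make it onto, so y = x + w with w nonnegative. *)
  have sub : (fset_set (+%R x @` [set w | int_labeling (t - k) w]) `<=`
              fset_set [set x | pos_labeling t x])%fset.
    rewrite -fset_set_sub; last 2 first.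
      by apply: finite_image; exact: finite_int_labeling.
      exact: finite_pos_labeling.
    by move=> _ [w wl <-]; exact: shift.
  have /eqP E : fset_set (+%R x @` [set w | int_labeling (t - k) w]) ==
              fset_set [set x | pos_labeling t x].
    rewrite eqEfcard sub card_eq fset_set_image ?card_imfset //=.
    exact: finite_int_labeling.
  move: yin; rewrite -E in_fset_set; last first.
    by apply: finite_image; exact: finite_int_labeling.
  rewrite inE => -[w [[w0 _] _] <-]; by rewrite mxE lerDl.
(* Compare the sums of [x] and [y] around [u0]. *)
have kt t y : pos_labeling t y -> (k <= t)%N.
  move=> yp; have := xmin t y yp; have := yp.1.1.2 u0; have := xp.1.1.2 u0.
  by rewrite -(@ler_nat R) => <- <- xy; apply: ler_sum => i _.
split=> // [t tk|t /andP[t0 tk]]; last first.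
  rewrite ehrhart_interior_labeling // (_ : [set x | _] = set0) ?fset_set0 ?cardfs0 //.
  apply/seteqP; split=> // y /= /kt; by rewrite leqNgt tk.
rewrite ehrhart_interior_labeling ?(leq_trans k0) // ehrhart_labeling.
rewrite (_ : [set x | pos_labeling t x] = +%R x @` [set w | int_labeling (t - k) w]).
  rewrite fset_set_image ?card_imfset //; exact: finite_int_labeling.
apply/seteqP; split=> [y /= yp|_ [w wl <-]]; last exact: shift.
exists (y - x); last by rewrite addrC subrK.
have xy := xmin t y yp.
move: yp xp => [[[y0 ys] yi] y1] [[[x0 xs] xi] x1].
split; last by move=> i; rewrite !mxE rpredB.
split=> [i|u]; first by rewrite !mxE subr_ge0.
by rewrite vertex_sumD -scaleN1r vertex_sumZ ys xs mulN1r natrB.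
Qed.
End PositiveLabeling.
End Gorenstein.

(** * Vertex sums in grid coordinates *)

Section Star.
Local Open Scope ring_scope.

(* Sum around (i, j) of labels h i j on (i, j)-(i+1, j) and v i j on
   (i, j)-(i, j+1); values of h and v outside the grid are ignored. *)
Definition star (V : zmodType) (m n : nat) (h v : nat -> nat -> V) (i j : nat) : V :=
  (if i is i'.+1 then h i' j else 0) + (if (i.+1 < n)%N then h i j else 0) +
  ((if j is j'.+1 then v i j' else 0) + (if (j.+1 < m)%N then v i j else 0)).

Lemma star_transpose (V : zmodType) m n (h v : nat -> nat -> V) i j :
  star m n h v i j = star n m (fun a b => v b a) (fun a b => h b a) j i.
Proof. by rewrite /star addrC. Qed.

Lemma eq_star (V : zmodType) m n (h v h' v' : nat -> nat -> V) i j :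
  (forall a b, (a.+1 < n)%N -> (b < m)%N -> h a b = h' a b) ->
  (forall a b, (a < n)%N -> (b.+1 < m)%N -> v a b = v' a b) ->
  (i < n)%N -> (j < m)%N -> star m n h v i j = star m n h' v' i j.
Proof.
move=> eh ev li lj; rewrite /star; congr ((_ + _) + (_ + _)).
- by case: i li => // i li; rewrite eh.
- by case: ifP => // li'; rewrite eh.
- by case: j lj => // j lj; rewrite ev.
- by case: ifP => // lj'; rewrite ev.
Qed.

Lemma star_intr (R : pzRingType) m n (h v : nat -> nat -> int) i j :
  star m n (fun a b => (h a b)%:~R) (fun a b => (v a b)%:~R) i j =
  (star m n h v i j)%:~R :> R.
Proof.
rewrite /star !rmorphD /=; congr ((_ + _) + (_ + _)).
- by case: i.
- by case: ifP.
- by case: j.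
- by case: ifP.
Qed.

End Star.

(** * Labelings of the grid graph as pairs of functions on coordinates *)

Section Grid.
Local Open Scope ring_scope.
Variables (R : realType) (m n : nat).
Local Notation T := ('I_n * 'I_m)%type.
Local Notation adj := (grid_adj m n).
Local Notation vect := 'rV[R]_#|edges adj|.

Lemma grid_adjE (u v : T) : adj u v =
  [|| (v.1 == u.1.+1 :> nat) && (v.2 == u.2 :> nat),
      (u.1 == v.1.+1 :> nat) && (v.2 == u.2 :> nat),
      (v.1 == u.1 :> nat) && (v.2 == u.2.+1 :> nat) |
      (v.1 == u.1 :> nat) && (u.2 == v.2.+1 :> nat)].
Proof. by rewrite /grid_adj; case: u v => [a b] [a' b'] /=; apply/idP/idP; lia. Qed.

Lemma grid_adj_sym : symmetric adj.
Proof. by move=> u v; rewrite !grid_adjE; apply/idP/idP; lia. Qed.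

Definition grid_col (u : T) : bool := odd (u.1 + u.2).

Lemma grid_adj_col u v : adj u v -> grid_col v = ~~ grid_col u.
Proof.
rewrite grid_adjE /grid_col => /or4P[]/andP[/eqP h1 /eqP h2]; move: h1 h2;
  by move=> -> ->; rewrite /= ?addnS /= ?negbK.
Qed.

(** Indexed by natural numbers rather than ordinals, to avoid bound proofs in formulas; when an end
    falls outside the grid, the set is not an edge and has label 0. *)
Definition hedge (i j : nat) : {set T} :=
  [set u : T | ((u.1 == i :> nat) || (u.1 == i.+1 :> nat)) && (u.2 == j :> nat)]%SET.
Definition vedge (i j : nat) : {set T} :=
  [set u : T | (u.1 == i :> nat) && ((u.2 == j :> nat) || (u.2 == j.+1 :> nat))]%SET.

Lemma hedgeE (u v : T) : v.1 = u.1.+1 :> nat -> v.2 = u.2 :> nat ->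
  [set u; v]%SET = hedge u.1 u.2.
Proof.
case: u v => [a b] [a' b'] /= h1 h2; apply/setP => -[p q]; rewrite !inE /= !xpair_eqE.
by rewrite -!val_eqE /= h1 h2; apply/idP/idP; lia.
Qed.

Lemma vedgeE (u v : T) : v.1 = u.1 :> nat -> v.2 = u.2.+1 :> nat ->
  [set u; v]%SET = vedge u.1 u.2.
Proof.
case: u v => [a b] [a' b'] /= h1 h2; apply/setP => -[p q]; rewrite !inE /= !xpair_eqE.
by rewrite -!val_eqE /= h1 h2; apply/idP/idP; lia.
Qed.

Lemma mem_hedge i j : (hedge i j \in edges adj) = (i.+1 < n)%N && (j < m)%N.
Proof.
apply/idP/andP => [/edge_ends[[a b] [[a' b'] [uv E]]]|[hi hj]].
  have : (a, b) \in hedge i j by rewrite E !inE eqxx.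
  have : (a', b') \in hedge i j by rewrite E !inE eqxx orbT.
  move: uv (ltn_ord a) (ltn_ord a') (ltn_ord b); rewrite grid_adjE !inE /=.
  by move=> *; split; lia.
pose u : T := (Ordinal (ltnW hi), Ordinal hj); pose v : T := (Ordinal hi, Ordinal hj).
rewrite -(@hedgeE u v) // (mem_edges grid_adj_sym grid_adj_col) grid_adjE.
by rewrite /= !eqxx.
Qed.

Lemma mem_vedge i j : (vedge i j \in edges adj) = (i < n)%N && (j.+1 < m)%N.
Proof.
apply/idP/andP => [/edge_ends[[a b] [[a' b'] [uv E]]]|[hi hj]].
  have : (a, b) \in vedge i j by rewrite E !inE eqxx.
  have : (a', b') \in vedge i j by rewrite E !inE eqxx orbT.
  move: uv (ltn_ord a) (ltn_ord b') (ltn_ord b); rewrite grid_adjE !inE /=.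
  by move=> *; split; lia.
pose u : T := (Ordinal hi, Ordinal (ltnW hj)); pose v : T := (Ordinal hi, Ordinal hj).
rewrite -(@vedgeE u v) // (mem_edges grid_adj_sym grid_adj_col) grid_adjE.
by rewrite /= !eqxx !orbT.
Qed.

Lemma grid_edgeP e : e \in edges adj ->
  (exists i j, [/\ (i.+1 < n)%N, (j < m)%N & e = hedge i j]) \/
  (exists i j, [/\ (i < n)%N, (j.+1 < m)%N & e = vedge i j]).
Proof.
move=> /edge_ends[u [v [uv ->]]].
have := uv; rewrite grid_adjE => /or4P[]/andP[/eqP h1 /eqP h2].
- by left; exists u.1, u.2; rewrite -h1 (hedgeE h1 h2).
- by left; exists v.1, v.2; rewrite -h1 finset.setUC (hedgeE h1).
- by right; exists u.1, u.2; rewrite -h2 (vedgeE h1 h2).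
- by right; exists v.1, v.2; rewrite -h2 finset.setUC (vedgeE _ h2).
Qed.

Definition hlabel (x : vect) i j := edge_label x (hedge i j).
Definition vlabel (x : vect) i j := edge_label x (vedge i j).

Lemma edge_label_in (x : vect) e : e \in edges adj ->
  exists2 k, enum_val k = e & edge_label x e = x ord0 k.
Proof.
move=> ee; exists (enum_rank_in ee e); first by rewrite enum_rankK_in.
by rewrite -edge_label_val enum_rankK_in.
Qed.

Lemma vertex_sum_grid (x : vect) (u : T) :
  vertex_sum x u = star m n (hlabel x) (vlabel x) u.1 u.2.
Proof.
rewrite (vertex_sumE grid_adj_sym grid_adj_col) /star.
pose F v := edge_label x [set u; v]%SET.
have sumE (p : pred T) z : (forall v, p v -> F v = z) ->
    (forall v w, p v -> p w -> v = w) ->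
    \sum_(v | p v) F v = if [exists v, p v] then z else 0.
  move=> pz p1; case: ifPn => [/existsP[v pv]|].
    rewrite (big_pred1 v) ?pz // => w; apply/idP/eqP => [pw|->//]; exact: p1.
  rewrite negb_exists => /forallP np; rewrite big_pred0 // => v.
  by rewrite (negbTE (np v)).
have Tinj (v w : T) : v.1 = w.1 :> nat -> v.2 = w.2 :> nat -> v = w.
  by case: v w => [a b] [a' b'] /= /val_inj -> /val_inj ->.
(* Left, right, lower and upper neighbour of [u]: an adjacent vertex satisfies exactly one of the
   four predicates, and each predicate holds for at most one vertex. *)
pose pl (v : T) := (u.1 == v.1.+1 :> nat) && (v.2 == u.2 :> nat).
pose pr (v : T) := (v.1 == u.1.+1 :> nat) && (v.2 == u.2 :> nat).
pose pd (v : T) := (v.1 == u.1 :> nat) && (u.2 == v.2.+1 :> nat).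
pose pu (v : T) := (v.1 == u.1 :> nat) && (v.2 == u.2.+1 :> nat).
have split4 : \sum_v F v = (\sum_(v | pl v) F v + \sum_(v | pr v) F v) +
    (\sum_(v | pd v) F v + \sum_(v | pu v) F v).
  rewrite [\sum_(v | pl v) _]big_mkcond [\sum_(v | pr v) _]big_mkcond.
  rewrite [\sum_(v | pd v) _]big_mkcond [\sum_(v | pu v) _]big_mkcond.
  rewrite -!big_split; apply: eq_bigr => v _ /=.
  have [av|nav] := boolP (adj u v); last first.
    by rewrite /F (edge_label0 grid_adj_sym grid_adj_col) // !if_same !addr0.
  move: av; rewrite grid_adjE => av.
  have : (pl v + pr v + pd v + pu v)%N = 1%N.
    by move: av; rewrite /pl /pr /pd /pu; lia.
  by case: (pl v) (pr v) (pd v) (pu v) => [] [] [] [] //=; rewrite ?addr0 ?add0r.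
rewrite -/F split4; congr ((_ + _) + (_ + _)).
- rewrite (sumE _ (hlabel x u.1.-1 u.2)).
  + case ui: (nat_of_ord u.1) => [|i].
      by case: existsP => // -[v]; rewrite /pl ui.
    have hi : (i < n)%N by rewrite ltnW // -ui ltn_ord.
    case: existsP => // -[]; exists (Ordinal hi, u.2).
    by rewrite /pl ui /= !eqxx.
  + move=> v /andP[/eqP h1 /eqP h2].
    by rewrite /F /hlabel finset.setUC (hedgeE h1) // h1 h2.
  + by move=> v w /andP[/eqP h1 /eqP h2] /andP[/eqP h3 /eqP h4]; apply: Tinj; lia.
- rewrite (sumE _ (hlabel x u.1 u.2)).
  + case: ifPn => [/existsP[v /andP[/eqP h1 _]]|].
      by rewrite -h1 ltn_ord.
    rewrite negb_exists => /forallP np; case: ifPn => // hi.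
    by have := np (Ordinal hi, u.2); rewrite /pr /= !eqxx.
  + by move=> v /andP[/eqP h1 /eqP h2]; rewrite /F /hlabel (hedgeE h1).
  + by move=> v w /andP[/eqP h1 /eqP h2] /andP[/eqP h3 /eqP h4]; apply: Tinj; lia.
- rewrite (sumE _ (vlabel x u.1 u.2.-1)).
  + case uj: (nat_of_ord u.2) => [|j].
      by case: existsP => // -[v]; rewrite /pd uj andbF.
    have hj : (j < m)%N by rewrite ltnW // -uj ltn_ord.
    case: existsP => // -[]; exists (u.1, Ordinal hj).
    by rewrite /pd uj /= !eqxx.
  + move=> v /andP[/eqP h1 /eqP h2].
    by rewrite /F /vlabel finset.setUC (vedgeE _ h2) // h1 h2.
  + by move=> v w /andP[/eqP h1 /eqP h2] /andP[/eqP h3 /eqP h4]; apply: Tinj; lia.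
- rewrite (sumE _ (vlabel x u.1 u.2)).
  + case: ifPn => [/existsP[v /andP[_ /eqP h1]]|].
      by rewrite -h1 ltn_ord.
    rewrite negb_exists => /forallP np; case: ifPn => // hi.
    by have := np (u.1, Ordinal hi); rewrite /pu /= !eqxx.
  + by move=> v /andP[/eqP h1 /eqP h2]; rewrite /F /vlabel (vedgeE h1).
  + by move=> v w /andP[/eqP h1 /eqP h2] /andP[/eqP h3 /eqP h4]; apply: Tinj; lia.
Qed.

(* The two coordinate sums over the ends of an edge are (2i+1, 2j) for
   hedge i j and (2i, 2j+1) for vedge i j. *)
Definition grid_row (h v : nat -> nat -> int) : vect :=
  \row_k let a := (\sum_(u in (enum_val k : {set T})) u.1)%N in
         let b := (\sum_(u in (enum_val k : {set T})) u.2)%N in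
         (if odd a then h a./2 b./2 else v a./2 b./2)%:~R.

Lemma hlabel_grid_row h v i j : (i.+1 < n)%N -> (j < m)%N ->
  hlabel (grid_row h v) i j = (h i j)%:~R.
Proof.
move=> hi hj.
have [|k kE] := @edge_label_in (grid_row h v) (hedge i j).
  by rewrite mem_hedge hi hj.
rewrite /hlabel => ->; rewrite mxE kE.
pose u : T := (Ordinal (ltnW hi), Ordinal hj); pose w : T := (Ordinal hi, Ordinal hj).
have nuw : u \notin [set w]%SET.
  by rewrite inE xpair_eqE -val_eqE /= ltn_eqF.
rewrite -(@hedgeE u w) // !big_setU1 //= !big_set1 /=.
by rewrite addnS addnn /= odd_double /= uphalf_double addnn doubleK.
Qed.

Lemma vlabel_grid_row h v i j : (i < n)%N -> (j.+1 < m)%N ->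
  vlabel (grid_row h v) i j = (v i j)%:~R.
Proof.
move=> hi hj.
have [|k kE] := @edge_label_in (grid_row h v) (vedge i j).
  by rewrite mem_vedge hi hj.
rewrite /vlabel => ->; rewrite mxE kE.
pose u : T := (Ordinal hi, Ordinal (ltnW hj)); pose w : T := (Ordinal hi, Ordinal hj).
have nuw : u \notin [set w]%SET.
  by rewrite inE xpair_eqE -!val_eqE /= eqxx /= ltn_eqF.
rewrite -(@vedgeE u w) // !big_setU1 //= !big_set1 /=.
by rewrite addnS !addnn /= odd_double /= uphalf_double doubleK.
Qed.

Lemma vertex_sum_grid_row h v (u : T) :
  vertex_sum (grid_row h v) u = (star m n h v u.1 u.2)%:~R.
Proof.
rewrite vertex_sum_grid -star_intr; apply: eq_star; rewrite ?ltn_ord //.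
  exact: hlabel_grid_row.
exact: vlabel_grid_row.
Qed.

(** The relation is binary so that the lemma serves for lower bounds, comparisons and equalities of
    labelings. *)
Lemma grid_label_ind (Q : R -> R -> Prop) (x y : vect) :
  (forall i j, (i.+1 < n)%N -> (j < m)%N -> Q (hlabel x i j) (hlabel y i j)) ->
  (forall i j, (i < n)%N -> (j.+1 < m)%N -> Q (vlabel x i j) (vlabel y i j)) ->
  forall k, Q (x ord0 k) (y ord0 k).
Proof.
move=> Qh Qv k; rewrite -!edge_label_val.
have [[i [j [hi hj ->]]]|[i [j [hi hj ->]]]] := grid_edgeP (enum_valP k).
  exact: Qh.
exact: Qv.
Qed.

Definition pos_grid (t : R) (h v : nat -> nat -> R) :=
  [/\ forall i j, (i.+1 < n)%N -> (j < m)%N -> 1 <= h i j,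
      forall i j, (i < n)%N -> (j.+1 < m)%N -> 1 <= v i j &
      forall i j, (i < n)%N -> (j < m)%N -> star m n h v i j = t].

Lemma pos_grid_label t (x : vect) : pos_labeling t x ->
  pos_grid t%:R (hlabel x) (vlabel x).
Proof.
move=> [[[x0 xs] _] x1]; split=> i j hi hj.
- have [|k _] := @edge_label_in x (hedge i j); first by rewrite mem_hedge hi hj.
  by rewrite /hlabel => ->.
- have [|k _] := @edge_label_in x (vedge i j); first by rewrite mem_vedge hi hj.
  by rewrite /vlabel => ->.
- by rewrite -(xs (Ordinal hi, Ordinal hj)) vertex_sum_grid.
Qed.

Definition pos_int_grid (t : nat) (h v : nat -> nat -> int) :=
  [/\ forall i j, (i.+1 < n)%N -> (j < m)%N -> 1 <= h i j,
      forall i j, (i < n)%N -> (j.+1 < m)%N -> 1 <= v i j &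
      forall i j, (i < n)%N -> (j < m)%N -> star m n h v i j = t%:Z].

Lemma pos_labeling_grid_row t h v : pos_int_grid t h v ->
  pos_labeling t (grid_row h v).
Proof.
move=> [h1 v1 st]; have x1 k : 1 <= grid_row h v ord0 k.
  apply: (@grid_label_ind (fun a _ => 1 <= a) _ (grid_row h v)) => i j hi hj.
    by rewrite hlabel_grid_row // ler1z h1.
  by rewrite vlabel_grid_row // ler1z v1.
split=> //; split; last by move=> k; rewrite mxE intr_int.
split=> [k|u]; first by rewrite (le_trans _ (x1 k)).
by rewrite vertex_sum_grid_row st ?ltn_ord.
Qed.

Hypotheses (m0 : (0 < m)%N) (n0 : (0 < n)%N).
Local Notation P := (perfect_matching_polytope R adj).

Let u0 : T := (Ordinal n0, Ordinal m0).

Lemma gorenstein_gridI k h v : (0 < k)%N -> pos_int_grid k h v ->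
  (forall t H V, pos_grid t H V ->
    (forall i j, (i.+1 < n)%N -> (j < m)%N -> (h i j)%:~R <= H i j) /\
    (forall i j, (i < n)%N -> (j.+1 < m)%N -> (v i j)%:~R <= V i j)) ->
  gorenstein P k.
Proof.
move=> k0 hv hmin; have xp := pos_labeling_grid_row hv.
apply/(gorenstein_labelingP u0 grid_adj_sym grid_adj_col xp); split=> //.
exists (grid_row h v) => // t y /pos_grid_label/hmin[hH vV].
apply: (@grid_label_ind (fun a b => a <= b)) => i j hi hj.
  by rewrite hlabel_grid_row // hH.
by rewrite vlabel_grid_row // vV.
Qed.

Lemma gorenstein_gridE k t0 h0 v0 : pos_int_grid t0 h0 v0 -> gorenstein P k ->
  exists H V, pos_grid k%:R H V /\ forall t h v, pos_int_grid t h v ->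
    (forall i j, (i.+1 < n)%N -> (j < m)%N -> H i j <= (h i j)%:~R) /\
    (forall i j, (i < n)%N -> (j.+1 < m)%N -> V i j <= (v i j)%:~R).
Proof.
move=> /pos_labeling_grid_row z.
move=> /(gorenstein_labelingP u0 grid_adj_sym grid_adj_col z)[_ [x xp xmin]].
exists (hlabel x), (vlabel x); split; first exact: pos_grid_label.
move=> t h v /pos_labeling_grid_row/xmin xy; split=> i j hi hj.
  rewrite -(hlabel_grid_row h v hi hj) /hlabel /edge_label.
  by apply: ler_sum.
rewrite -(vlabel_grid_row h v hi hj) /vlabel /edge_label.
by apply: ler_sum.
Qed.

End Grid.

(** * The Gorenstein grids with m = 2, m = 3 and m = n = 4 *)

Section Cases.
Local Open Scope ring_scope.
Variable R : realType.
Local Notation P m n := (perfect_matching_polytope R (grid_adj m n)).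

Lemma gorenstein_2_2 : gorenstein (P 2 2) 2.
Proof.
apply: (@gorenstein_gridI R 2 2 isT isT 2 (fun _ _ => 1) (fun _ _ => 1)) => //.
  by split=> // -[|[|i]] [|[|j]].
by move=> t H V [H1 V1 _]; split=> i j hi hj; rewrite ?H1 ?V1.
Qed.

(** Comparing the sums at a corner and at its horizontal neighbour cancels their common edge: the
    end vertical label is a sum of two labels, hence at least 2. *)
Lemma gorenstein_2_n n : (2 < n)%N -> gorenstein (P 2 n) 3.
Proof.
move=> n2; have n0 : (0 < n)%N by apply: leq_trans n2.
pose v (i _ : nat) : int := if (i == 0%N) || (i.+1 == n) then 2 else 1.
apply: (@gorenstein_gridI R 2 n isT n0 3 (fun _ _ => 1) v) => //.
  split=> // [i j _ _|i j hi hj]; first by rewrite /v; case: ifP.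
  rewrite /star /v; case: i hi => [|i] hi; case: j hj => [|[|j]] //= _;
    by repeat case: ifP; lia.
move=> t H V [H1 V1 S]; split=> i j hi hj; first by rewrite H1.
have {hj}-> : j = 0%N by lia.
rewrite /v; case: ifPn => [|_]; last by rewrite V1.
move=> /orP[/eqP i0|/eqP iE].
  have := S 0%N 0%N n0 isT; have := S 1%N 0%N (ltnW n2) isT.
  have := H1 1%N 0%N n2 isT; have := V1 1%N 0%N (ltnW n2) isT.
  by rewrite i0 /star /= n2 (ltnW n2) /= => *; lra.
case: i iE hi => [|[|i]] iE hi; try by lia.
have li : (i.+2 < n)%N by lia.
have := S i.+2 0%N hi isT; have := S i.+1 0%N (ltnW li) isT.
have := H1 i 0%N (ltnW li) isT; have := V1 i.+1 0%N (ltnW li) isT.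
rewrite /star /= li -iE ltnn /= => *; lra.
Qed.

(** The eight edges at the corners get 2, the others 1. Comparing a corner with the neighbour along
    one of its edges shows that its other edge carries a sum of two labels. *)
Lemma gorenstein_4_4 : gorenstein (P 4 4) 4.
Proof.
pose h (i j : nat) : int :=
  if ((i == 0%N) || (i == 2)) && ((j == 0%N) || (j == 3)) then 2 else 1.
apply: (@gorenstein_gridI R 4 4 isT isT 4 h (fun i j => h j i)) => //.
  split=> [i j _ _|i j _ _|]; try by rewrite /h; case: ifP.
  by move=> -[|[|[|[|i]]]] [|[|[|[|j]]]].
move=> t H V [H1 V1 S].
have S00 := S 0%N 0%N isT isT; have S10 := S 1%N 0%N isT isT.
have S20 := S 2%N 0%N isT isT; have S30 := S 3%N 0%N isT isT.
have S01 := S 0%N 1%N isT isT; have S02 := S 0%N 2%N isT isT.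
have S03 := S 0%N 3%N isT isT; have S13 := S 1%N 3%N isT isT.
have S23 := S 2%N 3%N isT isT; have S33 := S 3%N 3%N isT isT.
have S31 := S 3%N 1%N isT isT; have S32 := S 3%N 2%N isT isT.
have h10 := H1 1%N 0%N isT isT; have h13 := H1 1%N 3%N isT isT.
have h01 := H1 0%N 1%N isT isT; have h02 := H1 0%N 2%N isT isT.
have h21 := H1 2%N 1%N isT isT; have h22 := H1 2%N 2%N isT isT.
have v01 := V1 0%N 1%N isT isT; have v31 := V1 3%N 1%N isT isT.
have v10 := V1 1%N 0%N isT isT; have v20 := V1 2%N 0%N isT isT.
have v12 := V1 1%N 2%N isT isT; have v22 := V1 2%N 2%N isT isT.
rewrite /star /= in S00 S10 S20 S30 S01 S02 S03 S13 S23 S33 S31 S32.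
split=> -[|[|[|[|i]]]] [|[|[|[|j]]]] //= _ _; rewrite /h /=;
  try exact: H1; try exact: V1; lra.
Qed.

(** By the cut identity [D], a middle label at odd [i] is the sum of the two outer ones, hence at
    least 2. At even [i] the outer labels add up to t plus the middle one; as each is at most t - 2
    by [wide], each is at least 3. The end vertical labels are bounded as for m = 2. *)
Lemma gorenstein_3_n n : (3 < n)%N -> ~~ odd n -> gorenstein (P 3 n) 5.
Proof.
move=> n3 en; have n0 : (0 < n)%N by apply: leq_trans n3.
pose h (i j : nat) : int :=
  if odd i then (if j == 1%N then 2 else 1) else (if j == 1%N then 1 else 3).
pose v (i _ : nat) : int := if (i == 0%N) || (i.+1 == n) then 2 else 1.
apply: (@gorenstein_gridI R 3 n isT n0 5 h v) => //.
  split=> [i j _ _|i j _ _|i j hi hj].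
  - by rewrite /h; repeat case: ifP.
  - by rewrite /v; case: ifP.
  rewrite /star /v /h; case: i hi => [|i] hi; case: j hj => [|[|[|j]]] //= _;
    by repeat case: ifP; lia.
move=> t H V [H1 V1 S].
(* Counting colours to the left of a vertical cut. *)
have D i : (i.+1 < n)%N ->
    H i 0%N + H i 2%N - H i 1%N = if odd i then 0 else t.
  elim: i => [|i IH] hi.
    have := S 0%N 0%N n0 isT; have := S 0%N 1%N n0 isT; have := S 0%N 2%N n0 isT.
    by rewrite /star /= hi => *; lra.
  have li := ltnW hi; have := IH li.
  have := S i.+1 0%N li isT; have := S i.+1 1%N li isT; have := S i.+1 2%N li isT.
  by rewrite /star /= hi; case: (odd i) => /= *; lra.
(* Some end of this outer edge meets another horizontal edge and a vertical one, with label [w]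
   below; both labels are at least 1. *)
have wide i j : (i.+1 < n)%N -> (j == 0%N) || (j == 2%N) -> ~~ odd i -> H i j <= t - 2.
  move=> hi j02 ei; have [j3 sj] : (j < 3)%N /\
      forall a, (a < n)%N -> exists2 w, 1 <= w &
        (if a is a'.+1 then H a' j else 0) + (if (a.+1 < n)%N then H a j else 0) + w = t.
    move: j02 => /orP[]/eqP ->; split=> // a la.
      exists (V a 0%N); first exact: V1.
      by have := S a 0%N la isT; rewrite /star /= add0r.
    exists (V a 1%N); first exact: V1.
    by have := S a 2%N la isT; rewrite /star /= addr0.
  case: i hi ei => [|i] hi ei.
    have [w w1] := sj 1%N hi; have l2 : (2 < n)%N by lia.
    by have := H1 1%N j l2 j3; rewrite /= l2 => *; lra.
  have [w w1] := sj i.+1 (ltnW hi).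
  by have := H1 i j (ltnW hi) j3; rewrite /= hi => *; lra.
split=> i j hi hj.
  rewrite /h; case: ifPn => oi.
    case: eqP => [->|_]; last exact: H1.
    have := D i hi; rewrite oi => *.
    by have := H1 i 0%N hi isT; have := H1 i 2%N hi isT; lra.
  have := D i hi; rewrite (negbTE oi) => Di.
  have h1 := H1 i 1%N hi isT.
  case: eqP => [->|j1]; first exact: H1.
  have [->|->] : j = 0%N \/ j = 2%N by lia.
    by have := wide i 2%N hi isT oi; lra.
  by have := wide i 0%N hi isT oi; lra.
rewrite /v; case: ifPn => [|_]; last exact: V1.
have j01 : j = 0%N \/ j = 1%N by lia.
move=> /orP[/eqP i0|/eqP iE].
  have l2 : (2 < n)%N by lia.
  rewrite i0; case: j01 => ->.
    have := S 0%N 0%N n0 isT; have := S 1%N 0%N (ltnW l2) isT.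
    have := H1 1%N 0%N l2 isT; have := V1 1%N 0%N (ltnW l2) isT.
    by rewrite /star /= l2 (ltnW l2) /= => *; lra.
  have := S 0%N 2%N n0 isT; have := S 1%N 2%N (ltnW l2) isT.
  have := H1 1%N 2%N l2 isT; have := V1 1%N 1%N (ltnW l2) isT.
  by rewrite /star /= l2 (ltnW l2) /= => *; lra.
case: i iE hi => [|[|i]] iE hi; try by lia.
have li : (i.+2 < n)%N by lia.
case: j01 => ->.
  have := S i.+2 0%N hi isT; have := S i.+1 0%N (ltnW li) isT.
  have := H1 i 0%N (ltnW li) isT; have := V1 i.+1 0%N (ltnW li) isT.
  by rewrite /star /= li -iE ltnn /= => *; lra.
have := S i.+2 2%N hi isT; have := S i.+1 2%N (ltnW li) isT.
have := H1 i 2%N (ltnW li) isT; have := V1 i.+1 1%N (ltnW li) isT.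
by rewrite /star /= li -iE ltnn /= => *; lra.
Qed.

End Cases.

(** * Positive labelings of large grids built from unit squares *)

Section FaceLabelings.
Local Open Scope ring_scope.
Variables (m n : nat).

(* Starting from t copies of the matching by the vertical edges
   (i, 2j)-(i, 2j+1), add for each unit square with lower left corner (i, j) the
   number c i j to its horizontal edges and subtract it from its vertical ones;
   this does not change the sums around vertices. *)
Definition face_h (c : nat -> nat -> int) (i j : nat) : int :=
  (if (j.+1 < m)%N then c i j else 0) + (if j is j'.+1 then c i j' else 0).
Definition face_v (t : nat) (c : nat -> nat -> int) (i j : nat) : int :=
  (if odd j then 0 else t%:Z) -
  ((if (i.+1 < n)%N then c i j else 0) + (if i is i'.+1 then c i' j else 0)).

Lemma star_face t c i j : ~~ odd m -> (i < n)%N -> (j < m)%N ->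
  star m n (face_h c) (face_v t c) i j = t%:Z.
Proof.
move=> em hi hj; rewrite /star /face_h /face_v.
by case: i hi => [|i] hi; case: j hj => [|j] hj /=; repeat case: ifP => ? /=; lia.
Qed.

(** Horizontal labels become 2 on the two boundary rows and 1 elsewhere. With sum 5, vertical labels
    become 1 and 2 alternately in inner columns, 3 and 1 in the end columns. *)
Definition face_base (i j : nat) : int := if odd j then -1 else 2.
(** Changing the two lowest squares of column [a] from 2, -1 to 1, 0 lowers the label of the
    boundary edge (a, 0)-(a+1, 0) to 1. The vertical labels stay positive when the vertex columns
    [a] and [a+1] are both inner. *)
Definition face_low (a i j : nat) : int :=
  if (i == a) && (j < 2)%N then (if odd j then 0 else 1) else face_base i j.

Hypotheses (em : ~~ odd m) (m4 : (3 < m)%N).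

Lemma pos_face_base : (2 < n)%N ->
  pos_int_grid m n 5 (face_h face_base) (face_v 5 face_base).
Proof.
move=> n2; split=> i j hi hj; last exact: star_face.
  by rewrite /face_h /face_base; case: j hj => [|j] hj /=; repeat case: ifP => ? /=; lia.
by rewrite /face_v /face_base; case: i hi => [|i] hi /=; repeat case: ifP => ? /=; lia.
Qed.

Lemma pos_face_low a : (0 < a)%N -> (a.+2 < n)%N ->
  pos_int_grid m n 5 (face_h (face_low a)) (face_v 5 (face_low a)).
Proof.
move=> a0 an; split=> i j hi hj; last exact: star_face.
  by rewrite /face_h /face_low /face_base; case: j hj => [|j] hj /=;
    repeat case: ifP => ? /=; lia.
by rewrite /face_v /face_low /face_base; case: i hi => [|i] hi /=;
  repeat case: ifP => ? /=; lia.
Qed.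

End FaceLabelings.

(** * Grids that are not Gorenstein, empty polytopes, and paths *)

Section NotGorenstein.
Local Open Scope ring_scope.
Variable R : realType.
Local Notation P m n := (perfect_matching_polytope R (grid_adj m n)).

Lemma pos_int_grid_transpose m n t h v : pos_int_grid m n t h v ->
  pos_int_grid n m t (fun i j => v j i) (fun i j => h j i).
Proof.
move=> [h1 v1 st]; split=> i j hi hj; [exact: v1|exact: h1|].
by rewrite -star_transpose st.
Qed.

Lemma pos_grid_transpose m n (t : R) h v : pos_grid m n t h v ->
  pos_grid n m t (fun i j => v j i) (fun i j => h j i).
Proof.
move=> [h1 v1 st]; split=> i j hi hj; [exact: v1|exact: h1|].
by rewrite -star_transpose st.
Qed.

(* The three edges at the boundary vertex (2, 0) can be given label 1, whereas
   the inner vertex (1, 1) has degree four. *)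
Lemma no_least_pos_grid m n (k : R) H V : ~~ odd m -> (3 < m)%N -> (4 < n)%N ->
  pos_grid m n k H V ->
  ~ (forall t h v, pos_int_grid m n t h v ->
    (forall i j, (i.+1 < n)%N -> (j < m)%N -> H i j <= (h i j)%:~R) /\
    (forall i j, (i < n)%N -> (j.+1 < m)%N -> V i j <= (v i j)%:~R)).
Proof.
move=> em m3 n4 [H1 V1 S] le.
have m0 : (0 < m)%N by lia. have m1 : (1 < m)%N by lia. have m2 : (2 < m)%N by lia.
have n1 : (1 < n)%N by lia. have n2 : (2 < n)%N by lia. have n3 : (3 < n)%N by lia.
(* [face_base] bounds the vertical edge at (2, 0) by 1; [face_low 1] and [face_low 2] bound its left
   and right edges. *)
have [_ /(_ 2%N 0%N n2 m1)] := le _ _ _ (pos_face_base em m3 n2).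
have [/(_ 1%N 0%N n2 m0) + _] := le _ _ _ (@pos_face_low m n em m3 1 isT n3).
have [/(_ 2%N 0%N n3 m0) + _] := le _ _ _ (@pos_face_low m n em m3 2 isT n4).
rewrite /face_h /face_v /face_low /face_base /= m1 n3 /= => h2 h1 v2.
have := S 2%N 0%N n2 m0; have := S 1%N 1%N n1 m1.
have := H1 0%N 1%N n1 m1; have := H1 1%N 1%N n2 m1.
have := V1 1%N 0%N n1 m1; have := V1 1%N 1%N n1 m2.
rewrite /star /= n2 n3 m1 m2 => *; lra.
Qed.

Lemma not_gorenstein_big m n k : (3 < m)%N -> (4 < n)%N -> (m <= n)%N ->
  ~~ odd m || ~~ odd n -> ~ gorenstein (P m n) k.
Proof.
move=> m3 n4 mn mn_even.
have m0 : (0 < m)%N by lia. have n0 : (0 < n)%N by lia.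
have [em|om] := boolP (~~ odd m).
  have n2 : (2 < n)%N by lia.
  move=> /(gorenstein_gridE m0 n0 (pos_face_base em m3 n2))[H [V [HV]]].
  exact: no_least_pos_grid HV.
(* For odd [m] the roles of rows and columns are exchanged; m > 3 and odd give the required m >
   4. *)
have en : ~~ odd n by move: mn_even; rewrite (negbTE om).
have m4 : (4 < m)%N by lia. have m2 : (2 < m)%N by lia.
have n3 : (3 < n)%N by lia.
have z := pos_int_grid_transpose (pos_face_base en n3 m2).
move=> /(gorenstein_gridE m0 n0 z)[H [V [HV le]]].
apply: (no_least_pos_grid en n3 m4 (pos_grid_transpose HV)) => t h v hv.
have [hH vV] := le _ _ _ (pos_int_grid_transpose hv).
by split=> i j hi hj; [exact: vV|exact: hH].
Qed.

Local Open Scope classical_set_scope.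

(** Double counting of incidences: one matching edge at each vertex, two vertices on each edge by
    irreflexivity. *)
Lemma perfect_matching_card (T : finType) (adj : rel T) (M : {set {set T}}) :
  irreflexive adj -> perfect_matching adj M -> #|T| = (#|M| * 2)%N.
Proof.
move=> irr [Me M1]; rewrite -sum_nat_const -sum1_card.
rewrite (eq_bigr (fun u => \sum_(e in M) (u \in e))%N); last first.
  move=> u _; rewrite -[LHS](M1 u) -sum1_card [RHS]big_mkcond /= [LHS]big_mkcond /=.
  by apply: eq_bigr => e _; rewrite inE; case: (e \in M); case: (u \in e).
rewrite exchange_big /=; apply: eq_bigr => e eM.
have /edge_ends[u [v [uv ->]]] := fintype.subsetP Me _ eM.
rewrite -(_ : #|[set u; v]%SET| = 2%N); last first.
  by rewrite cards2; case: eqP uv => // ->; rewrite irr.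
rewrite -sum1_card [RHS]big_mkcond /=; apply: eq_bigr => w _.
by case: (w \in _).
Qed.

Lemma polytope_odd m n : odd m -> odd n -> P m n = set0.
Proof.
move=> om on; apply/seteqP; split=> // x [N [w [a [aM _ w1 _]]]].
case: N w a aM w1 => [|N] w a aM w1.
  by move: w1; rewrite big_ord0 => /eqP; rewrite eq_sym oner_eq0.
have [M Mp _] := aM ord0.
have irr : irreflexive (grid_adj m n).
  move=> u; apply/negP => /grid_adj_col; by case: grid_col.
have := perfect_matching_card irr Mp; rewrite card_prod !card_ord => E.
by have := oddM n m; rewrite om on E oddM andbF.
Qed.

(** Along a path the labels are forced from left to right to be 1, 0, 1, 0, and so on; for even [n]
    the last edge gets 1, as the last vertex requires. *)
Lemma polytope_path n : (0 < n)%N -> ~~ odd n ->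
  exists2 p, P 1 n = [set p] & forall i, p ord0 i \is a Num.int.
Proof.
move=> n0 en; pose h (i _ : nat) : int := ~~ odd i.
pose p := grid_row R 1 n h (fun _ _ => 0).
exists p; last by move=> i; rewrite mxE intr_int.
pose u0 : 'I_n * 'I_1 := (Ordinal n0, ord0).
(* Writing the polytope as its own dilate by 1 makes the description by labelings available. *)
have <- : dilate 1 (P 1 n) = P 1 n.
  apply/seteqP; split=> [x [y Py <-]|x Px]; first by rewrite scale1r.
  by exists x; rewrite ?scale1r.
rewrite (dilate_polytope R u0 (@grid_adj_sym 1 n) (@grid_adj_col 1 n)) //.
apply/seteqP; split=> [x [x0 xs]|x /= ->].
  have hx i : (i.+1 < n)%N -> hlabel x i 0 = (h i 0%N)%:~R.
    have st a (la : (a < n)%N) := xs (Ordinal la, ord0).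
    elim: i => [|i IH] hi.
      have := st 0%N n0; rewrite vertex_sum_grid /star /= hi /= /h /= => *; lra.
    have := st i.+1 (ltnW hi); rewrite vertex_sum_grid /star /= hi IH ?(ltnW hi) //.
    rewrite /h /=; case: (odd i) => /= *; lra.
  apply/rowP => k; apply: (@grid_label_ind R 1 n eq) => i j hi hj //.
  by rewrite hlabel_grid_row //; case: j hj => // _; exact: hx.
split=> [i|u]; first by rewrite mxE /h; case: ifP => _; rewrite ler0z.
rewrite vertex_sum_grid_row (_ : star _ _ _ _ _ _ = 1) //.
rewrite /star /h (ord1 u.2) /=; have := ltn_ord u.1.
by case: (nat_of_ord u.1) => [|i] hi /=; repeat case: ifP => ? /=; lia.
Qed.

End NotGorenstein.

(** * The classification *)

Local Open Scope classical_set_scope.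

Theorem theorem1p3 (R : realType) (m n : nat) (hm : (0 < m)%N)
    (hmn : (m <= n)%N) :
  let P := perfect_matching_polytope R (grid_adj m n) in
  [/\ (exists k : nat, gorenstein P k) <->
        [\/ m = 1%N /\ ~~ odd n, m = 2%N, m = 3%N /\ ~~ odd n
          | m = 4%N /\ n = 4%N],
      m = 1%N -> ~~ odd n -> exists x, P = [set x],
      m = 2%N -> forall k : nat,
        gorenstein P k <-> k = (if n == 2%N then 2%N else 3%N),
      m = 3%N -> ~~ odd n -> forall k : nat, gorenstein P k <-> k = 5%N
    & m = 4%N -> n = 4%N -> forall k : nat, gorenstein P k <-> k = 4%N].
Proof.
move=> P; have n0 : (0 < n)%N by exact: leq_trans hm hmn.
have index k0 : gorenstein P k0 -> forall k, gorenstein P k <-> k = k0.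
  by move=> g k; split=> [/gorenstein_uniq|->//]; exact.
have g2 : m = 2%N -> gorenstein P (if n == 2%N then 2%N else 3%N).
  move=> E; rewrite /P; subst m; have [->|n2] := eqVneq n 2%N.
    exact: gorenstein_2_2.
  by apply: gorenstein_2_n; rewrite ltn_neqAle eq_sym n2.
have g3 : m = 3%N -> ~~ odd n -> gorenstein P 5.
  move=> E en; rewrite /P; subst m; apply: gorenstein_3_n => //.
  by rewrite ltn_neqAle hmn andbT; apply: contraNneq en => <-.
have g4 : m = 4%N -> n = 4%N -> gorenstein P 4.
  by move=> Em En; rewrite /P; subst m n; exact: gorenstein_4_4.
split.
- split=> [[k gk]|[[m1 en]|m2|[m3 en]|[m4 n4]]]; last first.
  + by exists 4%N; exact: g4.
  + by exists 5%N; exact: g3.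
  + by eexists; exact: g2.
  + exists 1%N; rewrite /P; subst m.
    by have [p -> pi] := polytope_path R n0 en; exact: gorenstein_set1.
  (* If [m] and [n] are both odd, the polytope is empty, and the empty set has no index because L(0)
     = 1. *)
  have en : ~~ odd m || ~~ odd n.
    rewrite -negb_and; apply/negP => /andP[om on]; move: gk.
    by rewrite /P polytope_odd //; exact: gorenstein_set0.
  have [m3|m3] := leqP m 3.
    clear -hm en m3; case: m hm en m3 => [|[|[|[|m]]]] //= _ en _.
    * by constructor 1.
    * by constructor 2.
    * by constructor 3.
  have [n4|n4] := leqP n 4; last by case: (not_gorenstein_big m3 n4 hmn en gk).
  by constructor 4; split; apply/eqP; rewrite eqn_leq ?n4 ?m3 ?(leq_trans hmn) ?(leq_trans m3).
- move=> m1 en; rewrite /P; subst m.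
  by have [p -> _] := polytope_path R n0 en; exists p.
- by move=> m2; apply: index; exact: g2.
- by move=> m3 en; apply: index; exact: g3.
- by move=> m4 n4; apply: index; exact: g4.
Qed.
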